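(* Let $A$ be an $n\times n$ oscillatory matrix. For every $1\le j,k\le n-1$, $$e_j(A)\le Q_{j,k}\,e_k(A),$$ where $$Q_{j,k}=\left\lceil\max\left\{\frac{j}{k},\frac{n-j}{n-k}\right\}\right\rceil=\begin{cases}\left\lceil\dfrac{n-j}{n-k}\right\rceil,&j\le k,\\[6pt]\left\lceil\dfrac{j}{k}\right\rceil,&j\ge k.\end{cases}$$ More generally, every complete finite sequence $w$ of elements of $\{1,\dots,n-1\}$ satisfies $$t_j(w)\le Q_{j,k}\,t_k(w)\qquad(1\le j,k\le n-1).$$
   Context: All matrices are real and have order $n\ge2$. A matrix is totally nonnegative (TN) if all its minors are $\ge0$ and totally positive (TP) if all its minors are $>0$; a square TN matrix is oscillatory if some positive power of it is TP. For an $n\times n$ oscillatory matrix $A$ and $1\le k\le n$, $e_k(A)=\min\{m\ge1:\text{all minors of order }k\text{ of }A^m\text{ are positive}\}$. For $a\in\{1,\dots,n-1\}$ and $I\subseteq\{1,\dots,n\}$, let $c_a^+(I)=(I\setminus\{a\})\cup\{a+1\}$ if $a\in I$ and $a+1\notin I$, and $c_a^+(I)=I$ otherwise. For a finite sequence $w=(q_1,\dots,q_\ell)$ in $\{1,\dots,n-1\}$, a $w$-pass applies $c_{q_1}^+,\dots,c_{q_\ell}^+$ successively, in that order ($c_{q_1}^+$ first). With $L_k=\{1,\dots,k\}$ and $R_k=\{n-k+1,\dots,n\}$, $t_k(w)$ is the least number $m\ge1$ of repeated $w$-passes carrying $L_k$ to $R_k$ ($\infty$ if this never occurs). The sequence $w$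 is complete if every element of $\{1,\dots,n-1\}$ occurs in it. *)

(* Defs.v *)
From mathcomp Require Import all_boot all_order all_algebra.
From mathcomp Require Import boolp constructive_ereal reals.

Set Implicit Arguments.
Unset Strict Implicit.
Unset Printing Implicit Defensive.

Import Order.TTheory GRing.Theory Num.Theory.

Local Open Scope ring_scope.

Lemma exists_asbool (P : nat -> Prop) :
  (exists m, P m) -> exists m, `[< P m >].
Proof. by move=> [m Pm]; exists m; apply/asboolP. Qed.

Definition least (P : nat -> Prop) (h : exists m, P m) : nat :=
  ex_minn (exists_asbool h).

Lemma leastP (P : nat -> Prop) (h : exists m, P m) :
  P (least h) /\ forall m, P m -> (least h <= m)%N.
Proof.
rewrite /least; case: ex_minnP => m /asboolP Pm hmin.
by split=> // q Pq; apply: hmin; apply/asboolP.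
Qed.

Definition eleast (P : nat -> Prop) : \bar int :=
  if pselect (exists m, P m) is left h then (least h)%:Z%:E else +oo%E.

(* Increasing maps 'I_k -> 'I_n encode the k-element subsets of 'I_n. *)
Definition increasing (k n : nat) (f : 'I_k -> 'I_n) : Prop :=
  forall i j : 'I_k, (i < j)%N -> (f i < f j)%N.

(* For k > n there is no increasing map, hence no minor of order k; the only
   minor of order 0 is the empty determinant 1. *)
Definition minors_nonneg (R : realType) (n k : nat) (A : 'M[R]_n) : Prop :=
  forall f g : 'I_k -> 'I_n,
    increasing f -> increasing g -> 0 <= \det (mxsub f g A).

Definition minors_pos (R : realType) (n k : nat) (A : 'M[R]_n) : Prop :=
  forall f g : 'I_k -> 'I_n,
    increasing f -> increasing g -> 0 < \det (mxsub f g A).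

Definition totally_nonnegative (R : realType) (n : nat) (A : 'M[R]_n) : Prop :=
  forall k : nat, minors_nonneg k A.

Definition totally_positive (R : realType) (n : nat) (A : 'M[R]_n) : Prop :=
  forall k : nat, minors_pos k A.

Definition oscillatory (R : realType) (n : nat) (A : 'M[R]_n) : Prop :=
  totally_nonnegative A /\
  exists m : nat, (1 <= m)%N /\ totally_positive (A ^+ m).

Lemma oscillatory_minors_pos (R : realType) (n : nat) (A : 'M[R]_n) (k : nat) :
  oscillatory A -> exists m : nat, (1 <= m)%N /\ minors_pos k (A ^+ m).
Proof. by move=> [_ [m [m_gt0 TPm]]]; exists m; split. Qed.

Definition osc_exponent (R : realType) (n : nat) (A : 'M[R]_n)
    (hA : oscillatory A) (k : nat) : nat :=
  least (oscillatory_minors_pos k hA).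

(* Positions are numbered from 0: a : 'I_n.-1 stands for the letter a + 1 of
   {1, ..., n - 1}, and acts on the adjacent positions [pos a] and [next a]. *)
Lemma next_subproof (n : nat) (a : 'I_n.-1) : (a.+1 < n)%N.
Proof. by rewrite -ltn_predRL. Qed.

Definition pos (n : nat) (a : 'I_n.-1) : 'I_n := widen_ord (leq_pred n) a.
Definition next (n : nat) (a : 'I_n.-1) : 'I_n := Ordinal (next_subproof a).

Definition cplus (n : nat) (a : 'I_n.-1) (I : {set 'I_n}) : {set 'I_n} :=
  if (pos a \in I) && (next a \notin I) then next a |: (I :\ pos a) else I.

Definition pass (n : nat) (w : seq 'I_n.-1) (I : {set 'I_n}) : {set 'I_n} :=
  foldl (fun J a => cplus a J) I w.

Definition Lset (n k : nat) : {set 'I_n} := [set i : 'I_n | (i < k)%N].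
Definition Rset (n k : nat) : {set 'I_n} := [set i : 'I_n | (n - k <= i)%N].

Definition pass_time (n : nat) (w : seq 'I_n.-1) (k : nat) : \bar int :=
  eleast (fun m => (1 <= m)%N /\ iter m (pass w) (Lset n k) = Rset n k).

Definition complete_word (n : nat) (w : seq 'I_n.-1) : Prop :=
  forall a : 'I_n.-1, a \in w.

Definition Qconst (n j k : nat) : int :=
  Num.ceil (Num.max (j%:R / k%:R) ((n%:R - j%:R) / (n%:R - k%:R)) : rat).

(* Main.v *)
Require Import Defs.
From mathcomp Require Import all_boot all_order all_algebra.
From mathcomp Require Import boolp constructive_ereal reals.
From mathcomp Require Import perm.
From mathcomp Require Import zify ring.

Import Order.TTheory GRing.Theory Num.Theory.

Set Implicit Arguments.
Unset Strict Implicit.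
Unset Printing Implicit Defensive.

Local Open Scope ring_scope.

(** Both inequalities say that a system which can shift [k] particles on [n]
    sites as far as they can go within a given time can shift [j] particles
    within [Q] times that time.

    Matrices.  Put [B := A ^+ e_k], a nonsingular totally nonnegative matrix
    all of whose minors of order [k] are positive; the claim is that all minors
    of order [j] of [B ^+ Q] are positive.  Encode a set of [j] rows or columns
    by a binary word of length [n] with [j] letters [true] (particles) and
    [n - j] letters [false] (holes).  For words [u] and [v] with [j] particles,
    the minor of [B] with rows [u] and columns [v] is positive in two cases.
    - If [j <= k] and deleting [n - k] holes from [u] and from [v] gives the
      same word [c], of length [k]: the sites that survive carry a positive
      minor of order [k], of which the wanted minor is a principal minor
      ([word_pos_add_particles]).
    - If [k <= j] and deleting [k] particles from [u] and from [v] gives the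
      same word [c]: the deleted sites carry a positive minor of order [k], and
      in its Schur complement, which is again totally nonnegative and
      nonsingular after a change of signs, the wanted minor is again principal
      ([word_pos_add_holes]).
    In both cases the point is that principal minors of a nonsingular totally
    nonnegative matrix are positive ([minor_mask_gt0]), which follows by
    pivoting from the case of diagonal entries ([tn2_diag_gt0]).
    Two words with [j] particles always agree after deletion of all the [n - j]
    holes, or of all the [j] particles.  A deletion of [d * q] letters can be
    interpolated by [q] deletions of [d] letters ([near_split]), so by
    Cauchy-Binet [q] factors [B] suffice as soon as [n - j <= q * (n - k)],
    respectively [j <= q * k]; the least such [q] is [Q].

    Words.  Describe a set [I] of particles by the height function counting the
    elements of [I] that are at least [x].  A letter acts on it by a (min, +)
    linear update at a single site ([upper_cplus]), which is monotone and
    commutes with translations of the height.  Hence, with [p] particles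
    already packed at the right end, the next [k] particles move at least as
    well as [k] particles started from [Lset n k], until they are stopped by
    the packed ones: each block of [t_k] passes packs [k] more particles.  When
    [j <= k] the same comparison, read on holes, packs [n - k] more holes at
    the left end. *)

(** * Determinants and pivoting *)

Lemma det_scale_signs (F : comNzRingType) (r : nat) (a b : 'I_r -> F) (M : 'M[F]_r) :
  \det (\matrix_(i, j) (a i * b j * M i j)) = (\prod_i a i) * (\prod_j b j) * \det M.
Proof.
have -> : \matrix_(i, j) (a i * b j * M i j)
   = diag_mx (\row_i a i) *m M *m diag_mx (\row_j b j).
  by apply/matrixP=> i j; rewrite mul_mx_diag mul_diag_mx !mxE; ring.
rewrite !det_mulmx !det_diag.
under eq_bigr do rewrite mxE.
under [X in _ * _ * X = _]eq_bigr do rewrite mxE.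
ring.
Qed.

Lemma prod_sign_lt (F : pzRingType) (r p : nat) : (p <= r)%N ->
  \prod_(i < r) (-1) ^+ (i < p)%N = (-1) ^+ p :> F.
Proof.
move=> le_pr; rewrite prodrXr; congr (_ ^+ _).
have := @big_ord_widen nat 0%N addn p r (fun=> 1%N) le_pr.
rewrite big_const_ord iter_addn_0 mul1n => pE; rewrite [RHS]pE.
by rewrite [RHS]big_mkcond; apply: eq_bigr => i _; case: (i < p)%N.
Qed.

(** One step of Gaussian elimination with pivot in position [(p, q)].  The
    cofactor sign [(-1) ^+ (p + q)] is spread over the rows above and the
    columns before the pivot; with these signs the condensed matrix inherits
    the nonnegativity of all minors. *)
Lemma det_pivot (F : fieldType) (r : nat) (C : 'M[F]_r.+1) (p q : 'I_r.+1) :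
  C p q != 0 ->
  \det C = C p q * \det (\matrix_(i < r, j < r)
     ((-1) ^+ (i < p)%N * (-1) ^+ (j < q)%N *
      (C (lift p i) (lift q j) - C (lift p i) q * C p (lift q j) / C p q))).
Proof.
move=> piv.
(* Left multiplication by [E] clears column [q] outside row [p]. *)
pose E := \matrix_(i, j) ((i == j)%:R - (i != p)%:R * (j == p)%:R * (C i q / C p q)).
have detE : \det E = 1.
  rewrite (expand_det_row _ p) (bigD1 p) //= big1 => [|j jp]; last first.
    by rewrite !mxE eq_sym (negbTE jp) eqxx /= !mul0r subr0 mul0r.
  rewrite !mxE !eqxx /= !mul0r subr0 mul1r addr0 /cofactor -signr_odd oddD addbb mul1r.
  rewrite -[RHS](det1 F r); congr (\det _); apply/matrixP=> i j.
  by rewrite !mxE (inj_eq lift_inj) (eq_sym (lift p j)) (negbTE (neq_lift p j)) mulr0 mul0r subr0.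
have EC i j : (E *m C) i j = C i j - (i != p)%:R * (C i q * C p j / C p q).
  rewrite mxE (bigD1 i) //= !mxE eqxx.
  case: (eqVneq i p) => [->|ip].
    rewrite /= !mul0r !subr0 mul1r big1 ?addr0 // => l lp.
    by rewrite !mxE eq_sym (negbTE lp) eqxx /= !mul0r subr0 mul0r.
  rewrite !mulr0 !mul0r subr0 !mul1r; congr (_ + _).
  rewrite (bigD1 p) 1?eq_sym //= big1 => [|l /andP[li lp]].
    by rewrite !mxE eqxx (negbTE ip) /= addr0; ring.
  by rewrite !mxE eq_sym (negbTE li) (negbTE lp) /= mulr0 !mul0r subr0 mul0r.
have <- : \det (E *m C) = \det C by rewrite det_mulmx detE mul1r.
rewrite (expand_det_col _ q) (bigD1 p) //= big1 => [|i ip]; last first.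
  by rewrite EC ip mul1r mulfK // subrr mul0r.
rewrite EC eqxx mul0r subr0 addr0; congr (_ * _).
(* The signs multiply to [(-1) ^+ p * (-1) ^+ q], the sign of the cofactor. *)
pose M := \matrix_(i < r, j < r)
  (C (lift p i) (lift q j) - C (lift p i) q * C p (lift q j) / C p q).
have -> : \matrix_(i < r, j < r) ((-1) ^+ (i < p)%N * (-1) ^+ (j < q)%N *
      (C (lift p i) (lift q j) - C (lift p i) q * C p (lift q j) / C p q))
   = \matrix_(i, j) ((-1) ^+ (i < p)%N * (-1) ^+ (j < q)%N * M i j).
  by apply/matrixP=> i j; rewrite !mxE.
rewrite det_scale_signs !prod_sign_lt -1?ltnS // -exprD /cofactor; congr (_ * \det _).
apply/matrixP=> i j; rewrite mxE mxE EC mxE eq_sym (neq_lift p i) mul1r.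
by congr (_ - _); ring.
Qed.

(** * Diagonal entries of nonsingular totally nonnegative matrices *)

Lemma card_ord_below (n m : nat) : (m <= n)%N -> #|[set i : 'I_n | (i < m)%N]| = m.
Proof.
move=> le_mn; have := @big_ord_widen nat 0%N addn m n (fun=> 1%N) le_mn.
rewrite big_const_ord iter_addn_0 mul1n => mE; rewrite [RHS]mE -sum1_card.
by apply: eq_bigl => i; rewrite inE.
Qed.

(** The zero block has [p.+1] rows and [n - p] columns, one line too many: by
    the pigeonhole principle every permutation meets it. *)
Lemma det_zero_corner (F : comNzRingType) (n : nat) (C : 'M[F]_n) (p : 'I_n) :
  (forall i j : 'I_n, (i <= p)%N -> (p <= j)%N -> C i j = 0) -> \det C = 0.
Proof.
move=> C0; apply: big1 => s _.
have [/existsP[i /andP[ip pi]]|/existsPn nos] :=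
    boolP [exists i : 'I_n, (i <= p)%N && (p <= s i)%N].
  by rewrite (bigD1 i) //= C0 // mul0r mulr0.
have : s @: [set i : 'I_n | (i < p.+1)%N] \subset [set i : 'I_n | (i < p)%N].
  apply/subsetP=> y /imsetP[i]; rewrite inE ltnS => ip {y}->; rewrite inE.
  by move: (nos i); rewrite ip /= -ltnNge.
move/subset_leq_card; rewrite card_imset; last exact: perm_inj.
by rewrite !card_ord_below ?ltnn // ltnW.
Qed.

Section DiagonalEntries.
Variables (R : realDomainType) (n : nat).

Definition tn2 (C : 'M[R]_n) : Prop :=
  (forall i j, 0 <= C i j) /\
  (forall i k l j : 'I_n, (i < k)%N -> (l < j)%N -> C i j * C k l <= C i l * C k j).

Lemma det_row0 (C : 'M[R]_n) p : (forall j, C p j = 0) -> \det C = 0.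
Proof.
by move=> C0; rewrite (expand_det_row _ p) big1 // => j _; rewrite C0 mul0r.
Qed.

(** Unless row [p] is zero, it has a positive entry left of the diagonal, and
    the minors of order 2 through this entry spread the zeros of row [p] and
    column [p] to the whole north-east block with corner [(p, p)]. *)
Lemma tn2_hook0 (C : 'M[R]_n) (p : 'I_n) : tn2 C -> C p p = 0 ->
  (forall j : 'I_n, (p < j)%N -> C p j = 0) ->
  (forall k : 'I_n, (k < p)%N -> C k p = 0) -> \det C = 0.
Proof.
move=> [C_ge0 C2] Cpp row0 col0.
have [l Cpl|C0] := pickP (fun l => C p l != 0); last first.
  by apply: (det_row0 (p := p)) => j; apply/eqP; have := C0 j; case: eqP.
have Cpl_gt0 : 0 < C p l by rewrite lt0r Cpl C_ge0.
have lp : (l < p)%N.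
  by case: ltngtP Cpl => // [/row0->|/val_inj->]; rewrite ?Cpp eqxx.
apply: (det_zero_corner (p := p)) => i j; rewrite leq_eqVlt => /orP[/eqP/val_inj->|ip].
  by rewrite leq_eqVlt => /orP[/eqP/val_inj<-//|/row0].
rewrite leq_eqVlt => /orP[/eqP/val_inj<-|pj]; first exact: col0.
apply/le_anti; rewrite C_ge0 andbT -(pmulr_lle0 _ Cpl_gt0).
by have := C2 i p l j ip (ltn_trans lp pj); rewrite (row0 j) // mulr0.
Qed.

Lemma tn2_tr (C : 'M[R]_n) : tn2 C -> tn2 C^T.
Proof.
move=> [C_ge0 C2]; split=> [i j|i k l j ik lj]; rewrite !mxE //.
by rewrite mulrC; apply: C2.
Qed.

(** If [C p p = 0], the minors of order 2 with a corner in [(p, p)] show that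
    row [p] vanishes to the right of the diagonal or column [p] below it, and
    row [p] to the left or column [p] above: this leaves a zero line or a zero
    block that is too large. *)
Lemma tn2_diag_gt0 (C : 'M[R]_n) p : tn2 C -> \det C != 0 -> 0 < C p p.
Proof.
move=> C2 detC; rewrite lt0r C2.1 andbT; apply: contra detC => /eqP Cpp; apply/eqP.
have zero_or (P Q : pred 'I_n) (u v : 'I_n -> R) :
    (forall i j, P i -> Q j -> u i * v j <= 0) ->
    (forall i, 0 <= u i) -> (forall j, 0 <= v j) ->
    (forall i, P i -> u i = 0) \/ (forall j, Q j -> v j = 0).
  move=> uv u_ge0 v_ge0.
  have [i /andP[Pi ui]|u0] := pickP (fun i => P i && (u i != 0)); last first.
    by left=> i Pi; have := u0 i; rewrite Pi /=; case: eqP.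
  right=> j Qj; apply/le_anti; rewrite v_ge0 andbT.
  by rewrite -(pmulr_rle0 _ (_ : 0 < u i)) ?uv // lt0r ui u_ge0.
have [C_ge0 Cmin] := C2.
have half0 : (forall j : 'I_n, (p < j)%N -> C p j = 0) \/
             (forall k : 'I_n, (p < k)%N -> C k p = 0).
  apply: zero_or => // j k pj pk.
  by apply: le_trans (Cmin p k p j pk pj) _; rewrite Cpp mul0r.
have half1 : (forall j : 'I_n, (j < p)%N -> C p j = 0) \/
             (forall k : 'I_n, (k < p)%N -> C k p = 0).
  apply: zero_or => // j k jp kp.
  by rewrite mulrC; apply: le_trans (Cmin k p j p kp jp) _; rewrite Cpp mulr0.
case: half0 half1 => [rR|cB] [rL|cA].
- apply: (det_row0 (p := p)) => j.
  by case: (ltngtP j p) => [/rL|/rR|/val_inj->].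
- exact: (tn2_hook0 C2 Cpp rR cA).
- rewrite -det_tr; apply: (tn2_hook0 (p := p) (tn2_tr C2)); rewrite ?mxE // => i ip; rewrite mxE.
    exact: cB.
  exact: rL.
- rewrite -det_tr; apply: (det_row0 (p := p)) => j; rewrite mxE.
  by case: (ltngtP j p) => [/cA|/cB|/val_inj->].
Qed.
End DiagonalEntries.

(** * Minors indexed by sequences of sites *)

Section Pivot.
Variable R : realFieldType.
Implicit Types (B : nat -> nat -> R) (s t X Y : seq nat).

(** Rows and columns are indexed by natural numbers, so that the pivot row and
    column can be removed without renumbering the other ones; the order [r] is
    a parameter to keep the type of the matrix independent of [s] and [t]. *)
Definition minor (r : nat) B s t : R :=
  \det (\matrix_(i < r, j < r) B (nth 0%N s i) (nth 0%N t j)).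

(** The Schur complement of the entry [(a, b)], with the signs of
    [det_pivot]. *)
Definition condense (a b : nat) B : nat -> nat -> R := fun i j =>
  (-1) ^+ (i < a)%N * (-1) ^+ (j < b)%N * (B i j - B i b * B a j / B a b).

Definition tn B X Y : Prop := forall s t,
  subseq s X -> subseq t Y -> size s = size t -> 0 <= minor (size s) B s t.

Lemma nth_skip (a : nat) s1 s2 i :
  nth 0%N (s1 ++ a :: s2) (bump (size s1) i) = nth 0%N (s1 ++ s2) i.
Proof.
rewrite !nth_cat /bump; case: (leqP (size s1) i) => [le_si|lt_is]; last by rewrite add0n lt_is.
by rewrite ltnNge (leqW le_si) /= subSn.
Qed.

Lemma nth_ltn_pivot (a : nat) s1 s2 i :
  all (fun x => x < a)%N s1 -> all (fun x => a < x)%N s2 ->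
  (i < size (s1 ++ s2))%N -> (nth 0 (s1 ++ s2) i < a)%N = (i < size s1)%N.
Proof.
move=> /allP s1a /allP s2a; rewrite nth_cat size_cat.
case: (ltnP i (size s1)) => [lt_is _|le_si lt_i].
  exact: (s1a _ (mem_nth _ lt_is)).
by apply/negbTE; rewrite -leqNgt ltnW // s2a // mem_nth // ltn_subLR.
Qed.

Lemma minor_pivot (a b r : nat) B s1 s2 t1 t2 :
  size (s1 ++ s2) = r -> size (t1 ++ t2) = r ->
  all (fun x => x < a)%N s1 -> all (fun x => a < x)%N s2 ->
  all (fun x => x < b)%N t1 -> all (fun x => b < x)%N t2 ->
  B a b != 0 ->
  minor r.+1 B (s1 ++ a :: s2) (t1 ++ b :: t2) =
  B a b * minor r (condense a b B) (s1 ++ s2) (t1 ++ t2).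
Proof.
move=> sz_s sz_t s1a s2a t1b t2b piv.
have lt_s1 : (size s1 < r.+1)%N by rewrite ltnS -sz_s size_cat leq_addr.
have lt_t1 : (size t1 < r.+1)%N by rewrite ltnS -sz_t size_cat leq_addr.
rewrite /minor; set C := \matrix_(i, j) _.
pose p := Ordinal lt_s1; pose q := Ordinal lt_t1.
have Cpq : C p q = B a b by rewrite mxE !nth_cat !ltnn !subnn.
rewrite (det_pivot (p := p) (q := q)) Cpq //; congr (_ * \det _).
apply/matrixP=> i j; rewrite !mxE /= !nth_skip /condense.
by rewrite !nth_ltn_pivot ?sz_s ?sz_t // !nth_cat !ltnn !subnn.
Qed.

Lemma sorted_pivot (a : nat) s1 s2 : sorted ltn (s1 ++ a :: s2) ->
  [/\ all (fun x => x < a)%N s1, all (fun x => a < x)%N s2 & sorted ltn (s1 ++ s2)].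
Proof.
rewrite !(sorted_pairwise ltn_trans) !pairwise_cat /= => /and3P[+ -> /andP[-> ->]].
by rewrite allrel_consr => /andP[-> ->].
Qed.

Lemma subseq_cat_split (T : eqType) (s x1 x2 : seq T) : subseq s (x1 ++ x2) ->
  exists u v, [/\ s = u ++ v, subseq u x1 & subseq v x2].
Proof.
case/subseqP=> m sz_m ->; rewrite size_cat in sz_m.
exists (mask (take (size x1) m) x1), (mask (drop (size x1) m) x2).
rewrite !mask_subseq -mask_cat ?cat_take_drop //.
by rewrite size_take sz_m; case: ltngtP (leq_addr (size x2) (size x1)) => // ->.
Qed.

Lemma subseq_all (T : eqType) (P : pred T) (s x : seq T) :
  subseq s x -> all P x -> all P s.
Proof. by move=> sx /allP Px; apply/allP=> y /(mem_subseq sx)/Px. Qed.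

Lemma tn_sub B X Y X' Y' : tn B X Y -> subseq X' X -> subseq Y' Y -> tn B X' Y'.
Proof. by move=> tnB sX sY s t /subseq_trans sX' /subseq_trans sY'; apply: tnB; auto. Qed.

(** By [minor_pivot], the minors of the condensed array are minors of [B]
    divided by the pivot. *)
Lemma tn_condense (a b : nat) B X1 X2 Y1 Y2 :
  sorted ltn (X1 ++ a :: X2) -> sorted ltn (Y1 ++ b :: Y2) -> 0 < B a b ->
  tn B (X1 ++ a :: X2) (Y1 ++ b :: Y2) ->
  tn (condense a b B) (X1 ++ X2) (Y1 ++ Y2).
Proof.
move=> /sorted_pivot[X1a X2a _] /sorted_pivot[Y1b Y2b _] Bab tnB s t.
move=> /subseq_cat_split[s1 [s2 [-> s1X s2X]]] /subseq_cat_split[t1 [t2 [-> t1Y t2Y]]] sz.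
have [s1a s2a] := (subseq_all s1X X1a, subseq_all s2X X2a).
have [t1b t2b] := (subseq_all t1Y Y1b, subseq_all t2Y Y2b).
rewrite -(pmulr_rge0 _ Bab) -minor_pivot ?gt_eqF //.
have := tnB (s1 ++ a :: s2) (t1 ++ b :: t2).
rewrite [size (_ ++ a :: _)]size_cat /= addnS -size_cat; apply.
- by rewrite cat_subseq // -[a :: s2]cat1s -[a :: X2]cat1s cat_subseq.
- by rewrite cat_subseq // -[b :: t2]cat1s -[b :: Y2]cat1s cat_subseq.
- by move: sz; rewrite !size_cat /= !addnS => ->.
Qed.

Lemma nth_subseq2 (X : seq nat) i k : (i < k < size X)%N ->
  subseq [:: nth 0%N X i; nth 0%N X k] X.
Proof.
case/andP=> ik kX; rewrite -{3}(cat_take_drop k X) (drop_nth 0%N kX).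
rewrite -(nth_take 0%N ik) -[[:: _; _]]cat1s cat_subseq //.
  by rewrite sub1seq mem_nth // size_take kX.
by rewrite sub1seq mem_head.
Qed.

Lemma tn_entry_gt0 B X Y p : tn B X Y -> size X = size Y ->
  minor (size X) B X Y != 0 -> (p < size X)%N -> 0 < B (nth 0%N X p) (nth 0%N Y p).
Proof.
move=> tnB szXY nz ltp.
have := @tn2_diag_gt0 _ _ _ (Ordinal ltp) _ nz; rewrite mxE /=; apply.
split=> [i j|i k l j ik lj]; rewrite !mxE.
  have := tnB [:: nth 0%N X i] [:: nth 0%N Y j].
  by rewrite !sub1seq !mem_nth -?szXY // /minor det_mx11 mxE; apply.
have := tnB [:: nth 0%N X i; nth 0%N X k] [:: nth 0%N Y l; nth 0%N Y j].
rewrite !nth_subseq2 ?ik ?lj -?szXY //= => /(_ isT isT erefl).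
rewrite /minor (expand_det_row _ 0) !big_ord_recl big_ord0 /cofactor !det_mx11 !mxE /=.
by rewrite /bump /= addr0 expr0 expr1 mul1r mulN1r mulrN subr_ge0.
Qed.

Lemma split_at (T : Type) (w : seq T) p : (p < size w)%N ->
  exists w1 a w2, w = w1 ++ a :: w2 /\ size w1 = p.
Proof.
case: w => // x0 w ltp; exists (take p (x0 :: w)), (nth x0 (x0 :: w) p), (drop p.+1 (x0 :: w)).
by rewrite -drop_nth // cat_take_drop size_take ltp.
Qed.

Lemma size_split_tail (T : Type) (w w1 w2 : seq T) a p q :
  w = w1 ++ a :: w2 -> size w = (p + q.+1)%N -> size w1 = p -> size w2 = q.
Proof. by move=> -> szw sw1; move: szw; rewrite size_cat sw1 => /addnI[]. Qed.

Lemma split_first (b : bool) (m : seq bool) : b \in m ->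
  exists p m2, m = nseq p (~~ b) ++ b :: m2.
Proof.
elim: m => // c m IHm; rewrite inE; case: eqVneq => [<- _|bc /= /IHm[p [m2 ->]]].
  by exists 0%N, m.
by exists p.+1, m2; case: b c bc {IHm} => [] [].
Qed.

(** Principal minors, that is, rows and columns selected by the same mask.  A
    selected diagonal entry is positive; pivoting on it reduces the order and
    preserves total nonnegativity, nonsingularity and the equality of the
    masks. *)
Lemma minor_mask_gt0 B X Y m :
  sorted ltn X -> sorted ltn Y -> tn B X Y -> size X = size Y -> size m = size X ->
  minor (size X) B X Y != 0 -> 0 < minor (count id m) B (mask m X) (mask m Y).
Proof.
move cm: (count id m) => c; elim: c m B X Y cm => [|c IHc] m B X Y cm.
  by move=> *; rewrite /minor det_mx00.
move=> sX sY tnB szXY szm nz.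
have /split_first[p [m2 Em]] : true \in m.
  have : has id m by rewrite has_count cm.
  by case/hasP=> [[]].
have szm' : size m = (p + (size m2).+1)%N by rewrite Em size_cat size_nseq.
have ltp : (p < size X)%N by rewrite -szm szm' addnS ltnS leq_addr.
have [X1 [a [X2 [EX sX1]]]] := split_at ltp.
have [Y1 [b [Y2 [EY sY1]]]] : exists w1 a w2, Y = w1 ++ a :: w2 /\ size w1 = p.
  by apply: split_at; rewrite -szXY.
have Bab : 0 < B a b.
  have := tn_entry_gt0 tnB szXY nz ltp.
  by rewrite EX EY !nth_cat sX1 sY1 ltnn subnn.
have szX12 : size X = (size (X1 ++ X2)).+1 by rewrite EX !size_cat /= addnS.
have szY12 : size Y = (size (Y1 ++ Y2)).+1 by rewrite EY !size_cat /= addnS.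
have [X1a X2a sX12] := sorted_pivot (eq_ind _ (sorted ltn) sX _ EX).
have [Y1b Y2b sY12] := sorted_pivot (eq_ind _ (sorted ltn) sY _ EY).
have szX2 := size_split_tail EX (etrans (esym szm) szm') sX1.
have szY2 := size_split_tail EY (etrans (esym szXY) (etrans (esym szm) szm')) sY1.
have szXY12 : size (X1 ++ X2) = size (Y1 ++ Y2) by apply: succn_inj; rewrite -szX12 -szY12.
have maskE (Z1 Z2 : seq nat) z : size Z1 = p ->
    mask m (Z1 ++ z :: Z2) = [::] ++ z :: mask m2 Z2.
  by move=> sZ1; rewrite Em mask_cat ?size_nseq // mask_false.
have maskE' (Z1 Z2 : seq nat) : size Z1 = p ->
    mask (nseq p false ++ m2) (Z1 ++ Z2) = [::] ++ mask m2 Z2.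
  by move=> sZ1; rewrite mask_cat ?size_nseq // mask_false.
have cm2 : count id m2 = c.
  by move: cm; rewrite Em count_cat count_nseq mul0n /= => -[].
rewrite EX EY !maskE // minor_pivot ?cat0s ?size_mask ?(gt_eqF Bab) //; last 2 first.
- exact: subseq_all (mask_subseq _ _) X2a.
- exact: subseq_all (mask_subseq _ _) Y2b.
rewrite pmulr_rgt0 //.
have := IHc (nseq p false ++ m2) (condense a b B) (X1 ++ X2) (Y1 ++ Y2).
rewrite !maskE' //; apply=> //.
- by rewrite count_cat count_nseq mul0n.
- by apply: tn_condense => //; rewrite -?EX -?EY.
- by rewrite !size_cat size_nseq sX1 szX2.
- move: nz; rewrite szX12 EX EY minor_pivot ?(gt_eqF Bab) //.
  by rewrite mulf_eq0 negb_or => /andP[].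
Qed.

Lemma count_negb (w : seq bool) : (count id w + count negb w)%N = size w.
Proof. exact: count_predC id w. Qed.

Lemma count_mask_neg (T : Type) (P : pred T) (m : seq bool) (w : seq T) :
  size m = size w ->
  count P w = (count P (mask m w) + count P (mask (map negb m) w))%N.
Proof. by elim: w m => [|x w IHw] [|[] m] //= [/IHw->]; lia. Qed.

(** The rows [u] and columns [v] become the same word after deletion of the
    sites outside [m] and [m'], which all carry particles, and the minor on the
    deleted sites is positive.  Pivoting successively on the first deleted row
    and column removes them all, and leaves a principal minor. *)
Lemma minor_common_subword_gt0 e m m' u v B X Y :
  sorted ltn X -> sorted ltn Y -> tn B X Y -> size X = size Y ->
  minor (size X) B X Y != 0 ->
  size m = size X -> size u = size X -> size m' = size Y -> size v = size Y ->
  mask m u = mask m' v ->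
  all id (mask (map negb m) u) -> all id (mask (map negb m') v) ->
  count negb m = e ->
  0 < minor e B (mask (map negb m) X) (mask (map negb m') Y) ->
  0 < minor (count id u) B (mask u X) (mask v Y).
Proof.
elim: e m m' u v B X Y => [|e IHe] m m' u v B X Y sX sY tnB szXY nz szm szu szm' szv muv mu mv cm.
  have all_true w : count negb w = 0%N -> w = nseq (size w) true.
    by elim: w => // -[] w //= IHw /IHw {1}->.
  have cm' : count negb m' = 0%N.
    have := congr1 size muv; rewrite !size_mask ?szu ?szv //.
    move: (count_negb m) (count_negb m') cm szm szm' szXY; clear; lia.
  move: muv; rewrite (all_true _ cm) (all_true _ cm') !mask_true ?szm ?szm' ?szu ?szv // => <- _.
  exact: minor_mask_gt0.
have cm' : count negb m' = e.+1.
  have := congr1 size muv; rewrite !size_mask ?szu ?szv //.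
  move: (count_negb m) (count_negb m') cm szm szm' szXY; clear; lia.
have cuv : count id u = count id v.
  rewrite (count_mask_neg id (etrans szm (esym szu))) (count_mask_neg id (etrans szm' (esym szv))).
  rewrite muv; congr (_ + _)%N; move: mu mv; rewrite !all_count => /eqP-> /eqP->.
  by rewrite !size_mask ?size_map ?szm ?szm' // !count_map cm.
move=> KM_gt0.
have has_false w : count negb w = e.+1 -> false \in w.
  move=> cw; have : has negb w by rewrite has_count cw.
  by case/hasP=> [[]].
have /split_first[p [m2 Em]] := has_false _ cm.
have /split_first[q [n2 En]] := has_false _ cm'.
have szm2 : size m = (p + (size m2).+1)%N by rewrite Em size_cat size_nseq.
have szn2 : size m' = (q + (size n2).+1)%N by rewrite En size_cat size_nseq.
have szX' : size X = (p + (size m2).+1)%N by rewrite -szm.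
have szY' : size Y = (q + (size n2).+1)%N by rewrite -szm'.
have split_p (T : Type) (w : seq T) r k : size w = (r + k.+1)%N ->
    exists w1 a w2, [/\ w = w1 ++ a :: w2, size w1 = r & size w2 = k].
  move=> szw; have [|w1 [a [w2 [Ew sw1]]]] := @split_at _ w r.
    by rewrite szw addnS ltnS leq_addr.
  by exists w1, a, w2; split=> //; apply: size_split_tail Ew szw sw1.
have [X1 [a [X2 [EX sX1 sX2]]]] := split_p _ _ _ _ szX'.
have [Y1 [b [Y2 [EY sY1 sY2]]]] := split_p _ _ _ _ szY'.
have [u1 [x [u2 [Eu su1 su2]]]] := split_p _ _ _ _ (etrans szu szX').
have [v1 [y [v2 [Ev sv1 sv2]]]] := split_p _ _ _ _ (etrans szv szY').
(* [p] and [q] are the first deleted sites, so that nothing is deleted before. *)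
have delE (T : Type) (k : nat) (w : seq bool) (Z1 Z2 : seq T) z : size Z1 = k ->
    mask (map negb (nseq k true ++ false :: w)) (Z1 ++ z :: Z2) = z :: mask (map negb w) Z2.
  by move=> sZ; rewrite map_cat map_nseq mask_cat ?size_nseq // mask_false.
have delE' (T : Type) (k : nat) (w : seq bool) (Z1 Z2 : seq T) : size Z1 = k ->
    mask (map negb (nseq k true ++ w)) (Z1 ++ Z2) = mask (map negb w) Z2.
  by move=> sZ; rewrite map_cat map_nseq mask_cat ?size_nseq // mask_false.
have keepE (T : Type) (k : nat) (w : seq bool) (Z1 Z2 : seq T) z : size Z1 = k ->
    mask (nseq k true ++ false :: w) (Z1 ++ z :: Z2) = Z1 ++ mask w Z2.
  by move=> sZ; rewrite mask_cat ?size_nseq // mask_true ?sZ.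
have keepE' (T : Type) (k : nat) (w : seq bool) (Z1 Z2 : seq T) : size Z1 = k ->
    mask (nseq k true ++ w) (Z1 ++ Z2) = Z1 ++ mask w Z2.
  by move=> sZ; rewrite mask_cat ?size_nseq // mask_true ?sZ.
have [/eqP x1 mu2] : x == true /\ all id (mask (map negb m2) u2).
  by move: mu; rewrite Em Eu delE //= eqb_id => /andP.
have [/eqP y1 mv2] : y == true /\ all id (mask (map negb n2) v2).
  by move: mv; rewrite En Ev delE //= eqb_id => /andP.
rewrite {}x1 {}y1 in Eu Ev.
(* [a] and [b] come first in the minor on the deleted sites: a diagonal entry. *)
have Bab : 0 < B a b.
  have szK : size (mask (map negb m) X) = e.+1.
    by rewrite size_mask ?size_map // count_map -cm.
  have szM : size (mask (map negb m') Y) = e.+1.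
    by rewrite size_mask ?size_map // count_map -cm'.
  have tnKM : tn B (mask (map negb m) X) (mask (map negb m') Y).
    by apply: tn_sub tnB _ _; apply: mask_subseq.
  have := @tn_entry_gt0 _ _ _ 0 tnKM; rewrite szK szM gt_eqF // => /(_ erefl isT isT).
  by rewrite Em En EX EY !delE.
have [X1a X2a sX12] := sorted_pivot (eq_ind _ (sorted ltn) sX _ EX).
have [Y1b Y2b sY12] := sorted_pivot (eq_ind _ (sorted ltn) sY _ EY).
have cmE : count negb m2 = e by move: cm; rewrite Em count_cat count_nseq mul0n /= => -[].
have cnE : count negb n2 = e by move: cm'; rewrite En count_cat count_nseq mul0n /= => -[].
have maskE (w1 w2 : seq bool) (Z1 Z2 : seq nat) z : size w1 = size Z1 ->
    mask (w1 ++ true :: w2) (Z1 ++ z :: Z2) = mask w1 Z1 ++ z :: mask w2 Z2.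
  by move=> sw; rewrite mask_cat.
have szX12 : size X = (size (X1 ++ X2)).+1 by rewrite EX !size_cat /= addnS.
have szXY12 : size (X1 ++ X2) = size (Y1 ++ Y2).
  by move: szXY; rewrite EX EY !size_cat /= !addnS => -[].
have nz' : minor (size (X1 ++ X2)) (condense a b B) (X1 ++ X2) (Y1 ++ Y2) != 0.
  move: nz; rewrite szX12 EX EY minor_pivot ?(gt_eqF Bab) //.
  by rewrite mulf_eq0 negb_or => /andP[].
have cuv' : count id (u1 ++ u2) = count id (v1 ++ v2).
  by move: cuv; rewrite Eu Ev !count_cat /= !addnS => -[].
have cu : count id u = (count id (u1 ++ u2)).+1.
  by rewrite Eu !count_cat /= addnS.
rewrite cu Eu Ev EX EY !maskE ?su1 ?sv1 // minor_pivot ?(gt_eqF Bab) //; first last.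
- exact: subseq_all (mask_subseq _ _) Y2b.
- exact: subseq_all (mask_subseq _ _) Y1b.
- exact: subseq_all (mask_subseq _ _) X2a.
- exact: subseq_all (mask_subseq _ _) X1a.
- by rewrite cuv' -mask_cat ?sv1 // size_mask // !size_cat sv1 sv2 sY1 sY2.
- by rewrite -mask_cat ?su1 // size_mask // !size_cat su1 su2 sX1 sX2.
rewrite pmulr_rgt0 // -!mask_cat ?su1 ?sv1 //.
apply: (IHe (nseq p true ++ m2) (nseq q true ++ n2)) => //.
- by apply: tn_condense; rewrite -?EX -?EY.
- by rewrite !size_cat size_nseq sX1 sX2.
- by rewrite !size_cat su1 sX1 su2 sX2.
- by rewrite !size_cat size_nseq sY1 sY2.
- by rewrite !size_cat sv1 sY1 sv2 sY2.
- by move: muv; rewrite Em En Eu Ev !keepE // !keepE'.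
- by rewrite delE'.
- by rewrite delE'.
- by rewrite count_cat count_nseq mul0n.
move: KM_gt0; rewrite Em En EX EY !delE // !delE' //.
rewrite -[a :: _]cat0s -[b :: _]cat0s minor_pivot ?pmulr_rgt0 ?(gt_eqF Bab) //.
- by rewrite cat0s size_mask ?size_map // count_map.
- by rewrite cat0s size_mask ?size_map // count_map.
- exact: subseq_all (mask_subseq _ _) X2a.
- exact: subseq_all (mask_subseq _ _) Y2b.
Qed.
End Pivot.

(** * Interpolation between words *)

Section CommonSubwords.
Variable T : eqType.
Implicit Types (a : T) (P : pred T) (c u v w x y : seq T).

Lemma subseq_consP a c x : subseq (a :: c) x ->
  exists x1 x2, x = x1 ++ a :: x2 /\ subseq c x2.
Proof.
elim: x => //= b x IHx; case: eqP => [<- cx|_ /IHx[x1 [x2 [-> cx2]]]].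
  by exists [::], x.
by exists (b :: x1), x2.
Qed.

(** Insert into [c] the letters that [x] has in excess and those that [y] has
    in excess, the former first in each gap. *)
Lemma subseq_amalgam c x y : subseq c x -> subseq c y ->
  exists w, [/\ subseq x w, subseq y w &
    forall P, (count P w + count P c = count P x + count P y)%N].
Proof.
elim: c x y => [|a c IHc] x y.
  exists (x ++ y); rewrite prefix_subseq suffix_subseq; split=> // P.
  by rewrite count_cat addn0.
case/subseq_consP=> x1 [x2 [-> cx]] /subseq_consP[y1 [y2 [-> cy]]].
have [w [xw yw cw]] := IHc _ _ cx cy; exists (x1 ++ y1 ++ a :: w).
split=> [||P]; last by have := cw P; rewrite !count_cat /=; lia.
  rewrite cat_subseq // -[a :: x2]cat0s cat_subseq ?sub0seq //=.
  by rewrite eqxx.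
by rewrite -[y1 ++ _]cat0s cat_subseq ?sub0seq // cat_subseq //= eqxx.
Qed.

Lemma subseq_between c u s : subseq c u -> (size c <= s <= size u)%N ->
  exists x, [/\ subseq c x, subseq x u & size x = s].
Proof.
elim: u c s => [|b u IHu] c s.
  rewrite subseq0 => /eqP-> /=; rewrite leqn0 => /eqP->; by exists [::].
move=> cu /andP[cs]; rewrite leq_eqVlt => /orP[/eqP->|]; first by exists (b :: u).
move=> s_lt; have {s_lt} su : (s <= size u)%N by []; case: c cu cs => [_ _|a c].
  exists (take s u); rewrite sub0seq size_takel //.
  by rewrite (subseq_trans (take_subseq _ _) (subseq_cons _ _)).
rewrite /=; case: eqP => [<- cu|_ cu] cs.
  have [|x [cx xu sx]] := IHu c s.-1 cu; first by lia.
  by exists (a :: x); rewrite /= !eqxx; split=> //=; lia.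
have [|x [cx xu sx]] := IHu (a :: c) s cu; first by rewrite cs su.
by exists x; split=> //; apply: subseq_trans xu (subseq_cons _ _).
Qed.

(** At most [e] letters are deleted from each word to reach a common subword,
    and none of them satisfies [P]. *)
Definition near P (e : nat) u v : Prop := exists c,
  [/\ subseq c u, subseq c v, (size u <= size c + e)%N,
      count P c = count P u & count P c = count P v].

(** Starting from a common subword [c], restore [e] of the letters deleted from
    [u] and [d] of those deleted from [v]; the amalgam of the two results is an
    intermediate word. *)
Lemma near_split P d e u v : size u = size v -> near P (d + e) u v ->
  exists w, [/\ size w = size u, count P w = count P u, near P d u w & near P e w v].
Proof.
move=> szuv [c [cu cv szc cPu cPv]].
have [szcu szcv] := (size_subseq cu, size_subseq cv).
pose s := minn (size u) (size c + e).
have [|x [cx xu szx]] := @subseq_between c u s cu; first by rewrite /s; lia.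
have [|y [cy yv szy]] := @subseq_between c v (size c + (size u - s)) cv.
  by rewrite /s; lia.
have [w [xw yw cw]] := subseq_amalgam cx cy.
have szw : size w = size u by have := cw predT; rewrite !count_predT; rewrite /s in szx szy *; lia.
have := (leq_count_subseq P cx, leq_count_subseq P xu, leq_count_subseq P cy,
   leq_count_subseq P yv, cw P).
case=> [[[[h1 h2] h3] h4] h5].
exists w; split=> //; first lia.
  by exists x; split=> //; rewrite /s in szx; lia.
by exists y; split=> //; rewrite /s in szy; lia.
Qed.

(** A common subword can be shortened to any length that leaves room for its
    letters in [P]. *)
Lemma near_exact P e u v : near P e u v -> (e + count P u <= size u)%N ->
  exists c, [/\ subseq c u, subseq c v, (size c + e)%N = size u,
      count P c = count P u & count P c = count P v].
Proof.
move=> [c [cu cv szc cPu cPv]] le_e; have szcu := size_subseq cu.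
have [|x [fx xc szx]] := @subseq_between (filter P c) c (size u - e) (filter_subseq _ _).
  by rewrite size_filter; lia.
have Px : count P x = count P c.
  apply/eqP; rewrite eqn_leq leq_count_subseq //=.
  have := leq_count_subseq P fx.
  by rewrite count_filter (eq_count (a2 := P)) // => z /=; rewrite andbb.
exists x; rewrite !(subseq_trans xc) // Px; split=> //; lia.
Qed.

End CommonSubwords.

(** The common subword consists of all the letters [b]. *)
Lemma near_bool (b : bool) (e : nat) (u v : seq bool) :
  size u = size v -> count (pred1 b) u = count (pred1 b) v ->
  (size u <= count (pred1 b) u + e)%N -> near (pred1 b) e u v.
Proof.
move=> szuv cuv le_e.
have filterE w : filter (pred1 b) w = nseq (count (pred1 b) w) b.
  by elim: w => //= x w IHw; case: eqP => [->|_] /=; rewrite IHw.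
have cE k : count (pred1 b) (nseq k b) = k by rewrite count_nseq /= eqxx mul1n.
exists (nseq (count (pred1 b) u) b); split.
- by rewrite -filterE filter_subseq.
- by rewrite cuv -filterE filter_subseq.
- by rewrite size_nseq.
- exact: cE.
- by rewrite cE.
Qed.

(** * Products of totally nonnegative matrices *)

Section CauchyBinet.

Lemma perm_increasing (k n : nat) (phi : 'I_k -> 'I_n) : injective phi ->
  exists s : {perm 'I_k}, increasing (phi \o s).
Proof.
move=> phi_inj; pose below i := [set l | (phi l < phi i)%N].
have rank_lt i : (#|below i| < k)%N.
  rewrite -[ltnRHS]card_ord; apply: proper_card; apply/properP; split.
    exact/subsetP.
  by exists i; rewrite // inE ltnn.
pose rank i := Ordinal (rank_lt i).
have rank_mono i j : (phi i < phi j)%N -> (rank i < rank j)%N.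
  move=> lt_ij; apply: proper_card; apply/properP; split.
    by apply/subsetP=> l; rewrite !inE => /ltn_trans; apply.
  by exists i; rewrite !inE // ltnn.
have rank_inj : injective rank.
  move=> i j eq_ij; apply: phi_inj; apply: val_inj.
  by case: (ltngtP (phi i) (phi j)) => // /rank_mono; rewrite eq_ij ltnn.
exists (perm rank_inj)^-1%g => i j lt_ij /=.
have rankK l : rank ((perm rank_inj)^-1%g l) = l by rewrite -[RHS](permKV (perm rank_inj)) permE.
case: (ltngtP (phi _) (phi _)) => //.
  by move/rank_mono; rewrite !rankK ltnNge ltnW.
by move/val_inj/phi_inj/perm_inj => eq_ij; rewrite eq_ij ltnn in lt_ij.
Qed.

Variable R : realType.

Lemma det_rowsub_perm (k n : nat) (phi : 'I_k -> 'I_n) (s : {perm 'I_k}) (B : 'M[R]_(n, k)) :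
  \det (rowsub (phi \o s) B) = (-1) ^+ s * \det (rowsub phi B).
Proof.
have -> : rowsub (phi \o s) B = row_perm s (rowsub phi B) by apply/matrixP=> i j; rewrite !mxE.
by rewrite row_permE det_mulmx det_perm.
Qed.

Lemma det_colsub_perm (k n : nat) (phi : 'I_k -> 'I_n) (s : {perm 'I_k}) (A : 'M[R]_(k, n)) :
  \det (colsub (phi \o s) A) = (-1) ^+ s * \det (colsub phi A).
Proof.
have trE (psi : 'I_k -> 'I_n) : \det (colsub psi A) = \det (rowsub psi A^T).
  by rewrite -det_tr; congr (\det _); apply/matrixP=> i j; rewrite !mxE.
by rewrite !trE det_rowsub_perm.
Qed.

Lemma det_mulmx_rowsub (k n : nat) (A : 'M[R]_(k, n)) (B : 'M[R]_(n, k)) :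
  \det (A *m B) = \sum_(phi : {ffun 'I_k -> 'I_n})
    (\prod_i A i (phi i)) * \det (rowsub phi B).
Proof.
transitivity (\sum_(s : 'S_k) \sum_(phi : {ffun 'I_k -> 'I_n})
   (-1) ^+ s * \prod_i (A i (phi i) * B (phi i) (s i))).
  apply: eq_bigr => s _; rewrite -big_distrr /=; congr (_ * _).
  rewrite -(bigA_distr_bigA (fun i l => A i l * B l (s i))) /=.
  by apply: eq_bigr => i _; rewrite mxE.
rewrite exchange_big /=; apply: eq_bigr => phi _.
rewrite big_distrr /=; apply: eq_bigr => s _; rewrite big_split /= mulrCA.
by congr (_ * (_ * _)); apply: eq_bigr => i _; rewrite mxE.
Qed.

(** The Cauchy-Binet formula summed over all maps instead of increasing ones:
    an injective map and its increasing rearrangement contribute the same term,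
    and the other maps contribute 0, whence the factor [k`!].  This form
    determines the sign of the left-hand side without a choice of
    representatives. *)
Lemma Cauchy_Binet_sym (k n : nat) (A : 'M[R]_(k, n)) (B : 'M[R]_(n, k)) :
  k`!%:R * \det (A *m B) = \sum_(phi : {ffun 'I_k -> 'I_n})
    \det (colsub phi A) * \det (rowsub phi B).
Proof.
rewrite -card_Sn -sum1_card natr_sum big_distrl /=.
transitivity (\sum_(s : 'S_k) \sum_(phi : {ffun 'I_k -> 'I_n})
   (\prod_i A i (phi (s i))) * ((-1) ^+ s * \det (rowsub phi B))).
  apply: eq_big => [s|s _]; first by rewrite inE.
  rewrite mul1r det_mulmx_rowsub.
  pose h (phi : {ffun 'I_k -> 'I_n}) := [ffun i => phi (s i)].
  have h_bij : bijective h.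
    exists (fun phi : {ffun 'I_k -> 'I_n} => [ffun i => phi ((s^-1)%g i)]) => phi.
      by apply/ffunP=> i; rewrite !ffunE permKV.
    by apply/ffunP=> i; rewrite !ffunE permK.
  rewrite (reindex h) /=; last exact: onW_bij.
  apply: eq_bigr => phi _; rewrite -det_rowsub_perm.
  congr (_ * _); first by apply: eq_bigr => i _; rewrite ffunE.
  by congr (\det _); apply/matrixP=> i j; rewrite !mxE ffunE.
rewrite exchange_big /=; apply: eq_bigr => phi _.
rewrite -det_tr big_distrl /=; apply: eq_bigr => s _.
rewrite mulrCA mulrA; congr (_ * _ * _); apply: eq_bigr => i _; by rewrite !mxE.
Qed.

Variable n : nat.
Implicit Types A B : 'M[R]_n.

Lemma Cauchy_Binet_term_ge0 (k : nat) A B (f g phi : 'I_k -> 'I_n) :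
  minors_nonneg k A -> minors_nonneg k B -> increasing f -> increasing g ->
  0 <= \det (colsub phi (rowsub f A)) * \det (rowsub phi (colsub g B)).
Proof.
move=> A_ge0 B_ge0 incf incg.
have [/injectiveP/perm_increasing[s incs]|/injectivePn[i [j ij eq_ij]]] :=
    boolP (injectiveb phi); last first.
  rewrite (determinant_alternate (A := rowsub phi _) ij) ?mulr0 // => l.
  by rewrite !mxE eq_ij.
have sgn2 (x y : R) : x * y = ((-1) ^+ s * x) * ((-1) ^+ s * y).
  by rewrite mulrACA -signr_addb addbb mul1r.
rewrite sgn2 -det_colsub_perm -det_rowsub_perm; apply: mulr_ge0.
  have := A_ge0 f (phi \o s) incf incs.
  by congr (0 <= \det _); apply/matrixP=> i j; rewrite !mxE.
have := B_ge0 (phi \o s) g incs incg.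
by congr (0 <= \det _); apply/matrixP=> i j; rewrite !mxE.
Qed.

Lemma mxsub_mulmx (k : nat) A B (f g : 'I_k -> 'I_n) :
  mxsub f g (A *m B) = rowsub f A *m colsub g B.
Proof.
by apply/matrixP=> i j; rewrite !mxE; apply: eq_bigr => l _; rewrite !mxE.
Qed.

Lemma minors_nonneg_mul (k : nat) A B :
  minors_nonneg k A -> minors_nonneg k B -> minors_nonneg k (A *m B).
Proof.
move=> A_ge0 B_ge0 f g incf incg; rewrite mxsub_mulmx.
rewrite -(pmulr_rge0 _ (_ : 0 < k`!%:R)) ?ltr0n ?fact_gt0 // Cauchy_Binet_sym.
by apply: sumr_ge0 => phi _; apply: Cauchy_Binet_term_ge0.
Qed.

Lemma minor_mul_gt0 (k : nat) A B (f h g : 'I_k -> 'I_n) :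
  minors_nonneg k A -> minors_nonneg k B -> increasing f -> increasing g ->
  0 < \det (mxsub f h A) -> 0 < \det (mxsub h g B) -> 0 < \det (mxsub f g (A *m B)).
Proof.
move=> A_ge0 B_ge0 incf incg fhA hgB; rewrite mxsub_mulmx.
rewrite -(pmulr_rgt0 _ (_ : 0 < k`!%:R)) ?ltr0n ?fact_gt0 // Cauchy_Binet_sym.
rewrite (bigD1 (finfun h)) //= ltr_pwDl //; last first.
  by apply: sumr_ge0 => phi _; apply: Cauchy_Binet_term_ge0.
apply: mulr_gt0.
  by move: fhA; congr (0 < \det _); apply/matrixP=> i j; rewrite !mxE ffunE.
by move: hgB; congr (0 < \det _); apply/matrixP=> i j; rewrite !mxE ffunE.
Qed.
End CauchyBinet.

(** * Minors of powers of a totally nonnegative matrix *)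

(** When [m] keeps all the letters [true] of [u], selecting by [u] amounts to
    selecting by [m] first. *)
Lemma mask_mask (T : Type) (m u : seq bool) (s : seq T) :
  size m = size s -> size u = size s -> count id (mask m u) = count id u ->
  mask (mask m u) (mask m s) = mask u s.
Proof.
elim: s m u => [|x s IHs] [|[] m] [|y u] //= [szm] [szu].
  by move=> /addnI cu; rewrite IHs.
move=> cu; have := leq_count_mask id m u.
by case: y cu => [|/= cu _]; [lia|rewrite IHs].
Qed.

Section WordMinors.
Variables (R : realType) (n : nat) (i0 : 'I_n).
Implicit Types (A B : 'M[R]_n) (u v w : seq bool).

Let I := iota 0 n.

(** [i0] only provides a value outside the range of indices. *)
Definition entry A (i j : nat) : R := A (insubd i0 i) (insubd i0 j).

Lemma minor_mxsub (k : nat) A (f g : 'I_k -> 'I_n) (s t : seq nat) :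
  (forall i : 'I_k, nth 0%N s i = f i) -> (forall i : 'I_k, nth 0%N t i = g i) ->
  minor k (entry A) s t = \det (mxsub f g A).
Proof.
move=> sf tg; congr (\det _); apply/matrixP=> i j.
by rewrite !mxE /entry sf tg !valKd.
Qed.

Lemma increasing_of_subseq (k : nat) (s : seq nat) : subseq s I -> size s = k ->
  exists f : 'I_k -> 'I_n, increasing f /\ forall i : 'I_k, nth 0%N s i = f i.
Proof.
move=> sI sz; pose f (i : 'I_k) := insubd i0 (nth 0%N s i).
have fE (i : 'I_k) : nth 0%N s i = f i.
  rewrite val_insubd ifT //=.
  by have := mem_subseq sI (mem_nth 0%N (_ : (i < size s)%N)); rewrite sz mem_iota; apply.
exists f; split=> // i j lt_ij; rewrite -!fE.
have /(subseq_sorted ltn_trans sI) := iota_ltn_sorted 0 n.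
by move/(sorted_ltn_nth ltn_trans 0%N); apply; rewrite // inE sz.
Qed.

Lemma word_of_increasing (k : nat) (f : 'I_k -> 'I_n) : increasing f ->
  exists u, [/\ size u = n, count id u = k & forall i : 'I_k, nth 0%N (mask u I) i = f i].
Proof.
move=> incf; pose s := [seq val (f i) | i <- enum 'I_k].
have sI : filter (mem s) I = s.
  apply: (irr_sorted_eq ltn_trans ltnn).
  - exact: sorted_filter ltn_trans _ _ (iota_ltn_sorted 0 n).
  - apply: (homo_sorted (e := relpre val ltn)); first exact: incf.
    by rewrite -sorted_map val_enum_ord iota_ltn_sorted.
  move=> x; rewrite mem_filter /= mem_iota /= add0n.
  by case: (boolP (x \in s)) => // /mapP[i _ ->]; rewrite ltn_ord.
exists (map (mem s) I); rewrite size_map size_iota -filter_mask sI; split=> //.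
  by rewrite count_map -size_filter (eq_filter (a2 := mem s)) // sI size_map size_enum_ord.
move=> i; rewrite (nth_map i) ?size_enum_ord // nth_ord_enum //.
Qed.

Lemma tn_entry A : totally_nonnegative A -> tn (entry A) I I.
Proof.
move=> tnA s t sI tI szst.
have [f [incf fE]] := increasing_of_subseq sI erefl.
have [g [incg gE]] := increasing_of_subseq tI (esym szst).
by rewrite (minor_mxsub A fE gE); apply: tnA.
Qed.

Lemma minors_pos_entry (k : nat) A (s t : seq nat) : minors_pos k A ->
  subseq s I -> subseq t I -> size s = k -> size t = k -> 0 < minor k (entry A) s t.
Proof.
move=> posA sI tI szs szt.
have [f [incf fE]] := increasing_of_subseq sI szs.
have [g [incg gE]] := increasing_of_subseq tI szt.
by rewrite (minor_mxsub A fE gE); apply: posA.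
Qed.

Lemma minor_full A : minor (size I) (entry A) I I = \det A.
Proof.
rewrite size_iota (@minor_mxsub _ A id id) => [|i|i]; last 2 first.
- by rewrite nth_iota.
- by rewrite nth_iota.
by congr (\det _); apply/matrixP=> i j; rewrite mxE.
Qed.

(** The letters that may move in one step are those different from [b]: holes
    for [b = true], particles for [b = false]. *)
Definition word_pos (b : bool) (j e : nat) A : Prop := forall u v,
  size u = n -> size v = n -> count id u = j -> count id v = j ->
  near (pred1 b) e u v -> 0 < minor j (entry A) (mask u I) (mask v I).

Lemma count_true u : count (pred1 true) u = count id u.
Proof. by apply: eq_count => -[]. Qed.

Lemma count_false u : count (pred1 false) u = count negb u.
Proof. by apply: eq_count => -[]. Qed.

(** The common subword of length [k] embeds both index sets, in the same
    positions, in sets of [k] rows and [k] columns; the minor of order [j] is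
    principal in a positive minor of order [k]. *)
Lemma word_pos_add_particles (j k : nat) A : totally_nonnegative A ->
  minors_pos k A -> (j <= k <= n)%N -> word_pos true j (n - k) A.
Proof.
move=> tnA posA le_jkn u v szu szv cu cv /near_exact[].
  by rewrite count_true cu szu; lia.
move=> c [/subseqP[m szm Ec] /subseqP[m' szm' Ec'] szc].
rewrite !count_true => ccu ccv.
have sI (w : seq bool) : subseq (mask w I) I by exact: mask_subseq.
have ltnI : sorted ltn I by exact: iota_ltn_sorted.
have szI : size I = n by exact: size_iota.
have szc' : size c = k by move: szc le_jkn; rewrite szu; clear; lia.
have szK : size (mask m I) = k by rewrite size_mask ?szI ?szm // -(size_mask szm) -Ec.
have szM : size (mask m' I) = k by rewrite size_mask ?szI ?szm' // -(size_mask szm') -Ec'.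
have := @minor_mask_gt0 _ (entry A) (mask m I) (mask m' I) c.
rewrite {3}Ec {3}Ec' !mask_mask ?szm ?szm' ?szu ?szv ?szI -?Ec -?Ec' //.
rewrite ccu cu; apply.
- exact: subseq_sorted ltn_trans _ _ (sI m) ltnI.
- exact: subseq_sorted ltn_trans _ _ (sI m') ltnI.
- exact: tn_sub (tn_entry tnA) (sI m) (sI m').
- by rewrite szK szM.
- by rewrite szK.
by rewrite szK gt_eqF // minors_pos_entry.
Qed.

(** Exactly [k] particles are deleted from each index set; they carry a
    positive minor of order [k], on which one can pivot. *)
Lemma word_pos_add_holes (j k : nat) A : totally_nonnegative A -> \det A != 0 ->
  minors_pos k A -> (k <= j <= n)%N -> word_pos false j k A.
Proof.
move=> tnA detA posA le_kjn u v szu szv cu cv near_uv.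
have cnu := count_negb u; have cnv := count_negb v.
case: (near_exact near_uv) => [|c].
  by rewrite count_false szu; lia.
case=> [/subseqP[m szm Ec] /subseqP[m' szm' Ec'] szc].
rewrite !count_false => ccu ccv.
have szI : size I = n by exact: size_iota.
have all_del (w1 w2 : seq bool) : size w1 = size w2 ->
    count negb (mask w1 w2) = count negb w2 -> all id (mask (map negb w1) w2).
  move=> sz12; rewrite (count_mask_neg negb sz12) => /eqP.
  rewrite -[X in X == _]addn0 eqn_add2l eq_sym => /eqP c0.
  by rewrite all_count; apply/eqP; have := count_negb (mask (map negb w1) w2); lia.
have cm : count negb m = k.
  by apply/(@addnI (size c)); rewrite szc {1}Ec size_mask // count_negb.
have cm' : count negb m' = k.
  by apply/(@addnI (size c)); rewrite szc {1}Ec' size_mask // count_negb szm' szv szu.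
rewrite -cu; apply: (@minor_common_subword_gt0 _ k m m' u v) => //.
- exact: iota_ltn_sorted.
- exact: iota_ltn_sorted.
- exact: tn_entry.
- by rewrite minor_full.
- by rewrite szm szu szI.
- by rewrite szu szI.
- by rewrite szm' szv szI.
- by rewrite szv szI.
- by rewrite -Ec -Ec'.
- by apply: all_del; rewrite // -Ec.
- by apply: all_del; rewrite // -Ec'.
apply: minors_pos_entry => //; try exact: mask_subseq.
  by rewrite size_mask ?size_map ?szm ?szu ?szI // count_map.
by rewrite size_mask ?size_map ?szm' ?szv ?szI // count_map.
Qed.

Lemma increasing_of_word (k : nat) u : size u = n -> count id u = k ->
  exists f : 'I_k -> 'I_n, increasing f /\ forall i : 'I_k, nth 0%N (mask u I) i = f i.
Proof.
move=> szu cu; apply: increasing_of_subseq; first exact: mask_subseq.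
by rewrite size_mask // szu size_iota.
Qed.

Lemma word_pos_mul (b : bool) (j d e : nat) A B :
  totally_nonnegative A -> totally_nonnegative B ->
  word_pos b j d A -> word_pos b j e B -> word_pos b j (d + e) (A *m B).
Proof.
move=> tnA tnB posA posB u v szu szv cu cv /near_split.
rewrite szu szv => /(_ erefl)[w [szw cw uw wv]].
have cwj : count id w = j.
  have := (count_negb u, count_negb w); case: b {posA posB uw wv} cw.
    by rewrite !count_true => -> _.
  rewrite !count_false => -> [eu ew].
  by apply/(@addIn (count negb u)); rewrite ew szw -[in RHS]cu eu szu.
have [f [incf fE]] := increasing_of_word szu cu.
have [g [incg gE]] := increasing_of_word szv cv.
have [h [inch hE]] := increasing_of_word szw cwj.
rewrite (minor_mxsub _ fE gE); apply: (minor_mul_gt0 (h := h)) => //.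
  by rewrite -(minor_mxsub _ fE hE); apply: posA.
by rewrite -(minor_mxsub _ hE gE); apply: posB.
Qed.

Lemma tn_exp (q : nat) A : totally_nonnegative A -> totally_nonnegative (A ^+ q.+1).
Proof.
move=> tnA; elim: q => [|q IHq]; first by rewrite expr1.
by rewrite exprS => k; apply: minors_nonneg_mul.
Qed.

Lemma word_pos_exp (b : bool) (j d q : nat) A : totally_nonnegative A ->
  word_pos b j d A -> word_pos b j (q.+1 * d) (A ^+ q.+1).
Proof.
move=> tnA posA; elim: q => [|q IHq]; first by rewrite mul1n expr1.
by rewrite mulSn exprS; apply: word_pos_mul => //; apply: tn_exp.
Qed.

(** Any two words with [j] particles are related by moving all their holes, or
    all their particles; the hypotheses on [q] let [q.+1] steps do so. *)
Lemma minors_pos_exp (j k q : nat) A : totally_nonnegative A -> \det A != 0 ->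
  minors_pos k A -> (j <= n)%N -> (k <= n)%N ->
  ((j <= k)%N -> (n - j <= q.+1 * (n - k))%N) ->
  ((k <= j)%N -> (j <= q.+1 * k)%N) ->
  minors_pos j (A ^+ q.+1).
Proof.
move=> tnA detA posA le_jn le_kn hole_bound particle_bound f g incf incg.
have [u [szu cu fE]] := word_of_increasing incf.
have [v [szv cv gE]] := word_of_increasing incg.
have := (count_negb u, count_negb v); case=> cnu cnv.
rewrite -(minor_mxsub _ fE gE).
case: (leqP j k) => [le_jk|lt_kj].
  apply: (word_pos_exp (b := true) (d := n - k)) => //.
    by apply: word_pos_add_particles; rewrite ?le_jk.
  apply: near_bool; rewrite ?szu ?szv ?count_true ?cu ?cv //.
  by have := hole_bound le_jk; lia.
apply: (word_pos_exp (b := false) (d := k)) => //.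
  by apply: word_pos_add_holes; rewrite ?(ltnW lt_kj).
apply: near_bool; rewrite ?szu ?szv ?count_false //; first lia.
by have := particle_bound (ltnW lt_kj); lia.
Qed.
End WordMinors.

(** * The exclusion dynamics of a word *)

Section ExclusionDynamics.
Variable n : nat.
Implicit Types (a : 'I_n.-1) (I J : {set 'I_n}) (w : seq 'I_n.-1).

Definition upper I (x : nat) : nat := #|[set i in I | (x <= i)%N]|.

Lemma upper_step I (i : 'I_n) : upper I i = ((i \in I) + upper I i.+1)%N.
Proof.
rewrite /upper (cardsD1 i) !inE leqnn andbT; congr (_ + _)%N.
by apply: eq_card => l; rewrite !inE andbCA eq_sym -ltn_neqAle.
Qed.

Lemma upper0 I : upper I 0 = #|I|.
Proof. by apply: eq_card => l; rewrite !inE andbT. Qed.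

(** The move takes place exactly when the height drops by 1 from [a] to
    [a.+1] and is constant from [a.+1] to [a.+2]; in the three other cases the
    minimum is the old height. *)
Lemma upper_cplus a I x : upper (cplus a I) x =
  if x == a.+1 then minn (upper I a) (upper I a.+2).+1 else upper I x.
Proof.
have Ea := upper_step I (Defs.pos a); have En := upper_step I (Defs.next a).
rewrite /= in Ea En; rewrite /cplus.
case: ifPn => [/andP[Ia In]|]; last first.
  case: eqP => [-> |//]; rewrite Ea En.
  by case: (Defs.pos a \in I); case: (Defs.next a \in I) => //= _; clear; lia.
rewrite Ia (negbTE In) in Ea En.
case: (ltngtP x a.+1) => [lt_xa|lt_ax|->].
- rewrite /upper (cardsD1 (Defs.next a)) [RHS](cardsD1 (Defs.pos a)) !inE eqxx /= Ia.
  rewrite -[(x <= a)%N]/(x < a.+1)%N lt_xa (ltnW lt_xa); congr (_ + _)%N.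
  apply: eq_card => l; rewrite !inE.
  by case: eqVneq => [->|_]; rewrite ?(negbTE In) ?andbF //= -andbA.
- apply: eq_card => l; rewrite !inE.
  case: eqVneq => [->|_]; first by rewrite (negbTE In) /= leqNgt lt_ax.
  by case: eqVneq => [->|//]; rewrite /= leqNgt (ltn_trans _ lt_ax) ?andbF.
- have -> : upper (Defs.next a |: (I :\ Defs.pos a)) a.+1 = (upper I a.+1).+1.
    rewrite /upper (cardsD1 (Defs.next a)) !inE eqxx /= leqnn add1n; congr _.+1.
    apply: eq_card => l; rewrite !inE.
    case: eqVneq => [->|_]; first by rewrite (negbTE In).
    by case: eqVneq => [->|//]; rewrite /= ltnn andbF.
  by rewrite Ea En; clear; lia.
Qed.

(** The offsets [c1] and [c2] stand for a possibly negative translation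
    [c2 - c1] of heights; the cap [g] accounts for the particles of [J] that
    are stopped by those in front of them, or for a set [J] with too few
    particles to keep up with [I]. *)
Definition dominates (c1 c2 : nat) (g : nat -> nat) I J : Prop :=
  forall x, (x <= n)%N -> (minn (c2 + upper I x) (g x) <= upper J x + c1)%N.

(** The condition on [g] says that [g] is not decreased by the update of any
    letter; both sides of the domination being updated by the same monotone
    (min, +) linear rule, the inequality is preserved. *)
Lemma dominates_iter_pass c1 c2 g w m I J :
  (forall x, (x.+2 <= n)%N -> (g x.+1 <= g x)%N && (g x.+1 <= (g x.+2).+1)%N) ->
  dominates c1 c2 g I J ->
  dominates c1 c2 g (iter m (pass w) I) (iter m (pass w) J).
Proof.
move=> g_ok; elim: m => //= m IHm /IHm; move: (iter m _ I) (iter m _ J).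
rewrite /pass; elim: w {IHm I J} => //= a w IHw I J domIJ; apply: IHw => x le_xn.
rewrite !upper_cplus; case: eqP => [->|_]; last exact: domIJ.
have le_an : (a.+2 <= n)%N by exact: ltn_ord (Defs.next a).
move: (domIJ a (ltnW (ltnW le_an))) (domIJ a.+2 le_an) (g_ok a le_an).
by clear; lia.
Qed.

Lemma card_le_upper I x : (x <= n)%N -> (#|I| <= upper I x + x)%N.
Proof.
elim: x => [|x IHx] lt_xn; first by rewrite upper0 addn0.
apply: leq_trans (IHx (ltnW lt_xn)) _.
by rewrite (upper_step I (Ordinal lt_xn)) /=; case: (_ \in I); clear; lia.
Qed.

Lemma card_Lset k : (k <= n)%N -> #|Lset n k| = k.
Proof. exact: card_ord_below. Qed.

Lemma upper_Lset k x : (k <= n)%N -> upper (Lset n k) x = (k - x)%N.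
Proof.
move=> le_kn; rewrite -[in RHS](card_Lset le_kn) -(cardsID [set i : 'I_n | (i < minn x k)%N]).
have -> : Lset n k :&: [set i : 'I_n | (i < minn x k)%N] = [set i : 'I_n | (i < minn x k)%N].
  by apply/setP=> i; rewrite !inE; lia.
rewrite card_ord_below; last lia.
have -> : Lset n k :\: [set i : 'I_n | (i < minn x k)%N] = [set i in Lset n k | (x <= i)%N].
  by apply/setP=> i; rewrite !inE; lia.
rewrite -/(upper _ _).
case: (leqP x k) => [le_xk|lt_kx]; first lia.
suff -> : upper (Lset n k) x = 0%N by lia.
by apply: eq_card0 => i; rewrite !inE; lia.
Qed.

Lemma upper_Rset k x : (k <= n)%N -> upper (Rset n k) x = minn k (n - x).
Proof.
move=> le_kn; have -> : upper (Rset n k) x = upper (Lset n n) (maxn x (n - k)).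
  by apply: eq_card => i; have := ltn_ord i; rewrite !inE; clear; lia.
by rewrite upper_Lset //; move: le_kn; clear; lia.
Qed.

Lemma card_iter_pass w m I : #|iter m (pass w) I| = #|I|.
Proof.
elim: m => //= m <-; move: (iter m _ I) => J; rewrite /pass.
by elim: w J => //= a w IHw J; rewrite IHw -!upper0 upper_cplus.
Qed.

Lemma eq_Rset J j : #|J| = j -> (j <= n)%N -> (j <= upper J (n - j))%N -> J = Rset n j.
Proof.
move=> cJ le_jn le_jJ.
have EJ : [set i in J | (n - j <= i)%N] = J.
  apply/eqP; rewrite eqEcard cJ le_jJ andbT.
  by apply/subsetP=> i; rewrite inE => /andP[].
apply/eqP; rewrite eqEcard cJ -[#|Rset _ _|]upper0 upper_Rset // subn0.
rewrite (minn_idPl le_jn) leqnn andbT -EJ.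
by apply/subsetP=> i; rewrite !inE => /andP[].
Qed.

(** After [s] blocks of [t] passes, the [s * k] topmost particles (or all of
    them) are packed at the right end.  The induction compares [J] with
    [p] packed particles and [k] particles started from [Lset n k]. *)
Lemma reach_top_particles w k j t s x : (k <= j <= n)%N ->
  iter t (pass w) (Lset n k) = Rset n k -> (x <= n)%N ->
  (minn (minn (s * k) j) (n - x) <= upper (iter (s * t) (pass w) (Lset n j)) x)%N.
Proof.
move=> /andP[le_kj le_jn] reach; have le_kn := leq_trans le_kj le_jn.
elim: s x => [|s IHs] x le_xn; first by rewrite mul0n !min0n.
rewrite mulSn iterD; move: IHs (card_iter_pass w (s * t) (Lset n j)).
move: (iter _ _ (Lset n j)) => J IHs; rewrite card_Lset // => cJ.
(* If fewer than [k] particles are left, the block of [k] particles overlaps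
   with those already packed. *)
pose p := minn (s * k) (j - k).
have := @dominates_iter_pass 0 p (fun x => n - x)%N w t (Lset n k) J.
rewrite reach => dom.
have {dom} := dom _ _ x le_xn; rewrite upper_Rset // addn0 => dom.
have {dom} : (minn (p + minn k (n - x)) (n - x) <= upper (iter t (pass w) J) x)%N.
  apply: dom => [y le_yn|y le_yn]; first by apply/andP; split; clear -le_yn; lia.
  rewrite upper_Lset // addn0; have := IHs y le_yn; have := card_le_upper J le_yn.
  by rewrite cJ /p; move: le_kj le_jn; clear; lia.
by rewrite /p; move: le_kj le_jn le_xn; clear; lia.
Qed.

(** The mirror image: the number of holes below [x] is
    [upper J x + x - #|J|], and after [s] blocks of [t] passes the
    [s * (n - k)] lowest holes (or all of them) are packed at the left end. *)
Lemma reach_bottom_holes w k j t s x : (j <= k <= n)%N ->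
  iter t (pass w) (Lset n k) = Rset n k -> (x <= n)%N ->
  (j + minn (minn (s * (n - k)) (n - j)) x
     <= upper (iter (s * t) (pass w) (Lset n j)) x + x)%N.
Proof.
move=> /andP[le_jk le_kn] reach; have le_jn := leq_trans le_jk le_kn.
elim: s x => [|s IHs] x le_xn.
  by rewrite mul0n !min0n addn0 -{1}(card_Lset le_jn) card_le_upper.
rewrite mulSn iterD; move: IHs (card_iter_pass w (s * t) (Lset n j)).
move: (iter _ _ (Lset n j)) => J IHs; rewrite card_Lset // => cJ.
pose p := minn (s * (n - k)) (k - j).
have := @dominates_iter_pass (k - j - p) 0 (fun=> k - p)%N w t (Lset n k) J.
rewrite reach => dom.
have {dom} := dom _ _ x le_xn; rewrite upper_Rset // add0n => dom.
have {dom} : (minn (minn k (n - x)) (k - p) <= upper (iter t (pass w) J) x + (k - j - p))%N.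
  apply: dom => [y le_yn|y le_yn]; first by rewrite leqnn leqnSn.
  rewrite upper_Lset // add0n; have := IHs y le_yn; have := card_le_upper J le_yn.
  by rewrite cJ /p; move: le_jk le_kn; clear; lia.
by rewrite /p; move: le_jk le_kn le_xn; clear; lia.
Qed.

Lemma iter_pass_Rset w k j t q : (k <= n)%N -> (j <= n)%N ->
  ((j <= k)%N -> (n - j <= q * (n - k))%N) -> ((k <= j)%N -> (j <= q * k)%N) ->
  iter t (pass w) (Lset n k) = Rset n k ->
  iter (q * t) (pass w) (Lset n j) = Rset n j.
Proof.
move=> le_kn le_jn hole_bound particle_bound reach; apply: eq_Rset => //.
  by rewrite card_iter_pass card_Lset.
have le_njn : (n - j <= n)%N by exact: leq_subr.
case: (leqP j k) => [le_jk|/ltnW le_kj].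
  have := @reach_bottom_holes w k j t q (n - j)%N; rewrite le_jk => /(_ le_kn reach le_njn).
  by move: (hole_bound le_jk) le_jn; clear; lia.
have := @reach_top_particles w k j t q (n - j)%N; rewrite le_kj => /(_ le_jn reach le_njn).
by move: (particle_bound le_kj) le_jn; clear; lia.
Qed.
End ExclusionDynamics.

(** * The constant Q and the two inequalities *)

Lemma Qconst_le (n j k : nat) : (1 <= j <= n - 1)%N -> (1 <= k <= n - 1)%N ->
  (j <= k)%N -> Qconst n j k = Num.ceil ((n%:R - j%:R) / (n%:R - k%:R) : rat).
Proof.
move=> /andP[j_gt0 le_jn] /andP[k_gt0 le_kn] le_jk.
rewrite /Qconst max_r // -!natrB; [|lia..].
apply: (@le_trans _ _ 1).
  by rewrite ler_pdivrMr ?ltr0n // mul1r ler_nat.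
by rewrite ler_pdivlMr ?ltr0n ?mul1r ?ler_nat; lia.
Qed.

Lemma Qconst_ge (n j k : nat) : (1 <= j <= n - 1)%N -> (1 <= k <= n - 1)%N ->
  (k <= j)%N -> Qconst n j k = Num.ceil (j%:R / k%:R : rat).
Proof.
move=> /andP[j_gt0 le_jn] /andP[k_gt0 le_kn] le_kj.
rewrite /Qconst max_l // -!natrB; [|lia..].
apply: (@le_trans _ _ 1).
  by rewrite ler_pdivrMr ?ltr0n ?mul1r ?ler_nat; lia.
by rewrite ler_pdivlMr ?ltr0n // mul1r ler_nat.
Qed.

(** Both bounds hold whatever the order of [j] and [k], because [Q] is at least
    each of the two ratios. *)
Lemma Qconst_bounds (n j k : nat) : (1 <= j <= n - 1)%N -> (1 <= k <= n - 1)%N ->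
  exists q : nat, [/\ Qconst n j k = q.+1%:Z, (j <= q.+1 * k)%N
    & (n - j <= q.+1 * (n - k))%N].
Proof.
move=> /andP[j_gt0 le_jn] /andP[k_gt0 le_kn].
rewrite /Qconst -!natrB; [|lia..].
have nk_gt0 : (0 < n - k)%N by lia.
set x := Num.max _ _.
have x_gt0 : 0 < x by rewrite lt_max divr_gt0 ?ltr0n.
have : 0 < Num.ceil x by rewrite ceil_gt0.
have := ceil_ge x; case: (Num.ceil x) => [[|q]|q] // + _.
rewrite ge_max !ler_pdivrMr ?ltr0n // -!natrM !ler_nat => /andP[le_j le_nj].
by exists q.
Qed.

Lemma oscillatory_det (R : realType) (n : nat) (A : 'M[R]_n) :
  oscillatory A -> \det A != 0.
Proof.
case=> _ [[|m] [// _ /(_ n id id)]].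
have -> : mxsub id id (A ^+ m.+1) = A *m A ^+ m.
  by rewrite exprS; apply/matrixP=> i j; rewrite mxE.
move=> /(_ (fun _ _ => id) (fun _ _ => id)); rewrite det_mulmx => detAm.
by apply: contraTneq detAm => ->; rewrite mul0r ltxx.
Qed.

Lemma osc_exponent_le (R : realType) (n : nat) (A : 'M[R]_n) (hA : oscillatory A)
    (j k : nat) : (1 <= j <= n - 1)%N -> (1 <= k <= n - 1)%N ->
  (osc_exponent hA j)%:Z <= Qconst n j k * (osc_exponent hA k)%:Z.
Proof.
move=> j_in k_in; have [q [-> le_j le_nj]] := Qconst_bounds j_in k_in.
rewrite -PoszM lez_nat.
have [[m_gt0 posm] _] := leastP (oscillatory_minors_pos k hA).
rewrite /osc_exponent in posm *; apply: (leastP (oscillatory_minors_pos j hA)).2.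
move: (least _) m_gt0 posm => m m_gt0 posm.
have [le_jn le_kn] : (j <= n)%N /\ (k <= n)%N by lia.
have i0 : 'I_n by apply: (@Ordinal n 0); lia.
split; first by rewrite muln_gt0.
rewrite mulnC exprM; apply: (minors_pos_exp i0 (k := k)) => //.
  by case: m m_gt0 posm => // m _ _; apply: tn_exp => //; case: hA.
case: m m_gt0 posm => // m _ _.
elim: m => [|m IHm]; first by rewrite expr1 oscillatory_det.
by rewrite exprS det_mulmx mulf_neq0 // oscillatory_det.
Qed.

Lemma pass_time_le (n : nat) (w : seq 'I_n.-1) (j k : nat) :
  (1 <= j <= n - 1)%N -> (1 <= k <= n - 1)%N ->
  (pass_time w j <= (Qconst n j k)%:E * pass_time w k)%E.
Proof.
move=> j_in k_in; have [q [-> le_j le_nj]] := Qconst_bounds j_in k_in.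
rewrite /pass_time /eleast.
case: (pselect (exists m, _ /\ iter m (pass w) (Lset n k) = _)) => [hk|_]; last first.
  by rewrite mulry gtr0_sg // mul1e leey.
have [[t_gt0 reach] _] := leastP hk; move: (least hk) t_gt0 reach => t t_gt0 reach.
have reachj : (1 <= q.+1 * t)%N /\ iter (q.+1 * t) (pass w) (Lset n j) = Rset n j.
  split; first by rewrite muln_gt0.
  by apply: iter_pass_Rset reach => //; lia.
case: pselect => [hj|[]]; last by exists (q.+1 * t)%N.
by rewrite -EFinM lee_fin -PoszM lez_nat; apply: (leastP hj).2.
Qed.

Theorem theorem5p7 (R : realType) (n : nat) (hn : (2 <= n)%N) :
  (forall j k : nat, (1 <= j <= n - 1)%N -> (1 <= k <= n - 1)%N ->
     ((j <= k)%N ->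
        Qconst n j k = Num.ceil ((n%:R - j%:R) / (n%:R - k%:R) : rat)) /\
     ((k <= j)%N -> Qconst n j k = Num.ceil (j%:R / k%:R : rat)))
  /\
  (forall (A : 'M[R]_n) (hA : oscillatory A) (j k : nat),
     (1 <= j <= n - 1)%N -> (1 <= k <= n - 1)%N ->
     (osc_exponent hA j)%:Z <= Qconst n j k * (osc_exponent hA k)%:Z)
  /\
  (forall w : seq 'I_n.-1, complete_word w ->
   forall j k : nat, (1 <= j <= n - 1)%N -> (1 <= k <= n - 1)%N ->
     (pass_time w j <= (Qconst n j k)%:E * pass_time w k)%E).
Proof.
split=> [j k j_in k_in|].
  by split=> [le_jk|le_kj]; [exact: Qconst_le|exact: Qconst_ge].
split=> [A hA j k|w _ j k]; [exact: osc_exponent_le|exact: pass_time_le].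
Qed.
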